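(* Let $\mu\in\mathcal{F}^{11}$ be a filiform Lie bracket of dimension $11$ with parameters $(a_{r,s})_{(r,s)\in\Delta_{11}}$, and let $U^{11}$ be the Zariski open subset of $\mathcal{F}^{11}$ defined by $$a_{1,4}\ne 0,\quad a_{1,5}\ne 0,\quad 3a_{2,6}a_{1,5}(a_{1,4}-a_{2,6})\ne 2a_{2,7}a_{1,4}^2,\quad a_{2,6}\ne 0,\quad a_{3,8}\ne 0.$$ If $\mu\in U^{11}$, then the filiform Lie bracket $\mu_t=\mu+t\psi_{1,7}$ ($t\in\mathbb{C}$) is not isomorphic to $\mu$, except for $t=0$.
   Context: Let $n=11$ and let $x_0,\dots,x_{n-1}$ be a basis of $\mathbb{C}^n$. Let $\mu_0$ be the alternating bilinear map with $\mu_0(x_0,x_j)=x_{j+1}$ for $1\le j\le n-2$, and $\mu_0(x_i,x_j)=0$ for all other $i<j$. Let $\Delta_n=\{(r,s): 1\le r\le n-2,\ 2r+1<s\le n-1\}$ (here $n$ is odd). For $(r,s)\in\Delta_n$ let $\psi_{r,s}$ be the alternating bilinear map with $$\psi_{r,s}(x_i,x_j)=-\psi_{r,s}(x_j,x_i)=(-1)^{r-i}\binom{j-r-1}{r-i}x_{i+j+s-2r-1}$$ for $1\le i\le r<j\le n-1$ and $i+j+s-2r-1\le n-1$, and $\psi_{r,s}(x_i,x_j)=0$ otherwise. $\mathcal{F}^n$ is the algebraic set of tuples $(a_{r,s})_{(r,s)\in\Delta_n}$ of complex numbers such that $\psi=\sum_{(r,s)\in\Delta_n}a_{r,s}\psi_{r,s}$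 satisfies $\psi(\psi(X,Y),Z)+\psi(\psi(Y,Z),X)+\psi(\psi(Z,X),Y)=0$ for all $X,Y,Z$. The tuple is identified with the filiform Lie bracket $\mu=\mu_0+\psi$ on $\mathbb{C}^n$. A filiform Lie algebra of dimension $n$ is a nilpotent one of maximal class $n-1$. Isomorphic means isomorphic as complex Lie algebras. *)

(* Defs.v *)
From HB Require Import structures.
From mathcomp Require Import all_boot all_order all_algebra.
From mathcomp Require Import reals.
From mathcomp Require Import complex.

Set Implicit Arguments.
Unset Strict Implicit.
Unset Printing Implicit Defensive.

Import GRing.Theory.
Local Open Scope ring_scope.

Section LieBrackets.

Variables (K : fieldType) (V : vectType K).

Definition jacobi (b : V -> V -> V) : Prop :=
  forall X Y Z, b (b X Y) Z + b (b Y Z) X + b (b Z X) Y = 0.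

Definition lie_bracket (b : V -> V -> V) : Prop :=
  [/\ forall u, linear (b u), forall v, linear (b^~ v),
      forall u, b u u = 0 & jacobi b].

(* lower_central b k is the term C^k, with C^0 = V and C^(k+1) = [V, C^k];
   since b is meant to be bilinear, brackets of basis vectors span [V, C^k]. *)
Definition lower_central (b : V -> V -> V) (k : nat) : {vspace V} :=
  iter k (fun U => <<[seq b u v | u <- vbasis {:V}, v <- vbasis U]>>%VS) {:V}%VS.

(* Nilpotent of class exactly \dim V - 1, the maximal value. *)
Definition filiform (b : V -> V -> V) : Prop :=
  lower_central b (\dim {:V}).-1 = 0%VS /\
  lower_central b (\dim {:V}).-2 <> 0%VS.

Definition lie_isomorphic (b b' : V -> V -> V) : Prop :=
  exists f : {linear V -> V},
    bijective f /\ forall u v, f (b u v) = b' (f u) (f v).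

End LieBrackets.

Section FiliformFamily.

Variables (K : fieldType) (n : nat).
Local Notation V := 'rV[K]_n.

(* The basis x_0, ..., x_(n-1); x_ k = 0 for k >= n. *)
Definition basis_vec (k : nat) : V := \row_(j < n) (val j == k)%:R.
Local Notation x_ := basis_vec.

(* The alternating bilinear map with value f i j on (x_i, x_j) for i < j. *)
Definition altmap (f : nat -> nat -> V) (u v : V) : V :=
  \sum_(i < n) \sum_(j < n | (i < j)%N)
    (u 0 i * v 0 j - u 0 j * v 0 i) *: f i j.

Definition mu0 : V -> V -> V :=
  altmap (fun i j => if (i == 0)%N && (1 <= j <= n - 2)%N then x_ j.+1 else 0).

(* The index set Delta_n for n odd. *)
Definition Delta (r s : nat) : bool :=
  (1 <= r <= n - 2)%N && (2 * r + 1 < s <= n - 1)%N.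

(* The truncated subtractions on nat are exact when (r, s) is in Delta
   and 1 <= i <= r < j. *)
Definition psi_rs (r s : nat) : V -> V -> V :=
  altmap (fun i j =>
    if [&& (1 <= i <= r)%N, (r < j <= n - 1)%N
         & (i + j + s - 2 * r - 1 <= n - 1)%N]
    then ((-1) ^+ (r - i) * 'C(j - r - 1, r - i)%:R)
           *: x_ (i + j + s - 2 * r - 1)
    else 0).

(* A tuple (a_(r,s)) indexed by Delta_n is given by a function on nat * nat
   whose values outside Delta_n are never used. *)
Definition psi (a : nat -> nat -> K) (u v : V) : V :=
  \sum_(r < n) \sum_(s < n | Delta r s) a r s *: psi_rs r s u v.

Definition in_F (a : nat -> nat -> K) : Prop := jacobi (psi a).

Definition mu (a : nat -> nat -> K) (u v : V) : V := mu0 u v + psi a u v.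

End FiliformFamily.

Definition in_U11 (K : fieldType) (a : nat -> nat -> K) : Prop :=
  in_F 11 a /\
  [/\ a 1%N 4%N != 0, a 1%N 5%N != 0,
      3%:R * a 2%N 6%N * a 1%N 5%N * (a 1%N 4%N - a 2%N 6%N) != 2%:R * a 2%N 7%N * a 1%N 4%N ^+ 2,
      a 2%N 6%N != 0 & a 3%N 8%N != 0].

Definition mu_t (K : fieldType) (a : nat -> nat -> K) (t : K)
    (u v : 'rV[K]_11) : 'rV[K]_11 :=
  mu a u v + t *: psi_rs 1 7 u v.

(* Main.v *)
(* Give x_0 weight 1 and x_i weight i + 1 for i >= 1: then the parameter
   a_(r,s) of mu multiplies a bracket of weight s - 2 r - 2, so the shift
   t psi_(1,7) has weight 3. Let f be an isomorphism from mu_t to mu. It is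
   determined by f(x_0) and f(x_1), and it suffices to compare the brackets
   [x_1, x_2] and [x_2, x_3] in weights 0 to 3. Let c be the coefficient of x_0
   in f(x_0). Weight 0 makes the coefficient of x_1 in f(x_1) equal to c^2. In
   weight 1, the coefficient p_1 of x_1 in f(x_0) solves
   2 a_(1,4)^2 p_1 = a_(1,5) c (1 - c) and
   3 a_(2,6) (a_(1,4) - a_(2,6)) p_1 = a_(2,7) c (1 - c), whence c = 1 and
   p_1 = 0 on U. Weights 2 and 3 then give t = a_(2,6) S and, by the Jacobi
   identity on x_1, x_2, x_3, also a_(3,8) S = 0, for the same polynomial S in
   the remaining coefficients of f. *)
Require Import Defs.
From HB Require Import structures.
From mathcomp Require Import all_boot all_order all_algebra.
From mathcomp Require Import ring zify.
From mathcomp Require Import reals.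
From mathcomp Require Import complex.
Set Implicit Arguments.
Unset Strict Implicit.
Unset Printing Implicit Defensive.
Import GRing.Theory.
Local Open Scope ring_scope.

(** Reduces a consequence [z = 0] of one equation to an identity for [ring], with the multiplier [c]
    as certificate. *)
Lemma eq0_of_eq (R : pzRingType) (x y z : R) c :
  x = y -> z = c * (x - y) -> z = 0.
Proof. by move=> -> ->; rewrite subrr mulr0. Qed.

(** [lower_central] spans brackets of basis vectors only; bilinearity brings in all the others. *)
Lemma memv_bracket (K : fieldType) (vT : vectType K) (b : vT -> vT -> vT)
    (U W : {vspace vT}) u v :
    (forall u, linear (b u)) -> (forall v, linear (b^~ v)) ->
  u \in U -> v \in W ->
  b u v \in <<[seq b u v | u <- vbasis U, v <- vbasis W]>>%VS.
Proof.
move=> linr linl Uu Wv.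
pose br u : {linear vT -> vT} :=
  HB.pack (b u) (GRing.isLinear.Build _ _ _ _ (b u) (linr u)).
pose bl v : {linear vT -> vT} :=
  HB.pack (b^~ v) (GRing.isLinear.Build _ _ _ _ (b^~ v) (linl v)).
rewrite -[b u v]/(bl v u) (coord_vbasis Uu) linear_sum.
apply: memv_suml => i _; rewrite linearZ memvZ //=.
rewrite -[b _ v]/(br _ v) (coord_vbasis Wv) linear_sum.
apply: memv_suml => j _; rewrite linearZ memvZ //=.
apply/memv_span/allpairsP; exists ((vbasis U)`_i, (vbasis W)`_j).
by rewrite !mem_nth ?size_tuple.
Qed.

(** * Coordinates of [mu0], [psi] and [mu] in terms of 2 by 2 minors *)

Section Coordinates.

Variable K : fieldType.
Local Notation V := 'rV[K]_11.
Local Notation x_ := (@basis_vec K 11).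
Implicit Types (u v w : V) (a : nat -> nat -> K).

(** [inord] sends an index above 10 to 0, hence the bounds [k < 11] below. *)
Definition coor u (i : nat) : K := u 0 (inord i).

Definition plucker u v (i j : nat) : K :=
  coor u i * coor v j - coor u j * coor v i.

Lemma coor_ord u (i : 'I_11) : u 0 i = coor u i.
Proof. by rewrite /coor inord_val. Qed.

Lemma coorP u v : (forall k, (k < 11)%N -> coor u k = coor v k) -> u = v.
Proof. by move=> uv; apply/rowP => i; rewrite !coor_ord uv. Qed.

Lemma coorD u v k : coor (u + v) k = coor u k + coor v k.
Proof. exact: mxE. Qed.

(* Unlike !coorD, this does not unfold mu, itself a sum, in the summands. *)
Lemma coorDD u v w k : coor (u + v + w) k = coor u k + coor v k + coor w k.
Proof. by rewrite !coorD. Qed.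

Lemma coorZ c u k : coor (c *: u) k = c * coor u k.
Proof. exact: mxE. Qed.

Lemma coor0 k : coor (0 : V) k = 0.
Proof. exact: mxE. Qed.

Lemma coor_basis_vec i k : (k < 11)%N ->
  coor (x_ i) k = (k == i)%:R.
Proof. by move=> lt_k; rewrite /coor mxE /= inordK. Qed.

Lemma coor_altmap f u v k :
  coor (altmap f u v) k =
  \sum_(0 <= i < 11) \sum_(0 <= j < 11 | (i < j)%N)
    plucker u v i j * coor (f i j) k.
Proof.
rewrite /coor /altmap summxE big_mkord; apply: eq_bigr => i _.
rewrite summxE big_mkord; apply: eq_bigr => j _.
by rewrite !mxE !coor_ord.
Qed.

(* The entry ((r, s), (i, j), (e, m)) stands for the contribution
   (-1)^e m a_(r,s) of the pair (x_i, x_j) to the coordinate k of psi; listing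
   these entries lets them be found by computation. *)
Definition psi_support (k : nat) :
    seq (nat * nat * (nat * nat) * (bool * nat)) :=
  let sq := [seq (i, j) | i <- index_iota 0 11, j <- index_iota 0 11] in
  [seq let: (r, s, (i, j)) := q in
       (r, s, (i, j), (odd (r - i), 'C(j - r - 1, r - i)))
  | q <- [seq q <- [seq (p, p') | p <- sq, p' <- sq]
         | let: (r, s, (i, j)) := q in
           [&& Delta 11 r s, (i < j)%N, (1 <= i <= r)%N, (r < j <= 11 - 1)%N
             & k == (i + j + s - 2 * r - 1)%N]]].

Lemma coor_psi a u v k : (k < 11)%N ->
  coor (psi a u v) k =
  \sum_(q <- psi_support k)
     a q.1.1.1 q.1.1.2 *
       ((-1) ^+ q.2.1 * q.2.2%:R * plucker u v q.1.2.1 q.1.2.2).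
Proof.
move=> lt_k; rewrite big_map big_filter big_mkcond !big_allpairs.
rewrite {1}/coor /psi summxE big_mkord.
apply: eq_bigr => r _; rewrite summxE big_mkord big_mkcond.
apply: eq_bigr => s _; rewrite big_allpairs mxE coor_ord [psi_rs _ _ _ _]/psi_rs.
rewrite coor_altmap.
case: (boolP (Delta 11 r s)) => _ /=; last first.
  by rewrite big1 // => i _; rewrite big1.
rewrite big_distrr; apply: eq_bigr => i _.
rewrite big_mkcond big_distrr; apply: eq_bigr => j _ /=.
case: (i < j)%N => //=; last by rewrite mulr0.
rewrite /coor inord_val; case: ifP => [/andP[-> /andP[-> le_k]]|no_ij] /=.
  rewrite [X in _ * (_ * X)]mxE -/(coor _ _) coor_basis_vec // -signr_odd.
  case: eqP => _; rewrite ?mulr1 ?mulr0 //.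
  by rewrite [plucker _ _ _ _ * _]mulrC.
(* [psi_support] has no test that the target index is at most 10: this follows from its equality
   with [k]. *)
rewrite mxE !mulr0; case: ifP => // /and3P[i_r r_j /eqP k_ij].
by move: no_ij; rewrite i_r r_j -k_ij -ltnS lt_k.
Qed.

Section Explicit.

Variables (a : nat -> nat -> K) (u v : V).
Local Notation w := (plucker u v).

Definition psi_coor (k : nat) : K :=
  match k with
  | 4 => a 1 4 * w 1 2
  | 5 => a 1 5 * w 1 2 + a 1 4 * w 1 3
  | 6 => a 1 6 * w 1 2 + a 1 5 * w 1 3 + (a 1 4 - a 2 6) * w 1 4 +
    a 2 6 * w 2 3
  | 7 => a 1 7 * w 1 2 + a 1 6 * w 1 3 + (a 1 5 - a 2 7) * w 1 4 +
    (a 1 4 - 2%:R * a 2 6) * w 1 5 + a 2 7 * w 2 3 + a 2 6 * w 2 4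
  | 8 => a 1 8 * w 1 2 + a 1 7 * w 1 3 + (a 1 6 - a 2 8) * w 1 4 +
    (a 1 5 - 2%:R * a 2 7) * w 1 5 +
    (a 1 4 - 3%:R * a 2 6 + a 3 8) * w 1 6 + a 2 8 * w 2 3 +
    a 2 7 * w 2 4 + (a 2 6 - a 3 8) * w 2 5 + a 3 8 * w 3 4
  | 9 => a 1 9 * w 1 2 + a 1 8 * w 1 3 + (a 1 7 - a 2 9) * w 1 4 +
    (a 1 6 - 2%:R * a 2 8) * w 1 5 +
    (a 1 5 - 3%:R * a 2 7 + a 3 9) * w 1 6 +
    (a 1 4 - 4%:R * a 2 6 + 3%:R * a 3 8) * w 1 7 + a 2 9 * w 2 3 +
    a 2 8 * w 2 4 + (a 2 7 - a 3 9) * w 2 5 +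
    (a 2 6 - 2%:R * a 3 8) * w 2 6 + a 3 9 * w 3 4 + a 3 8 * w 3 5
  | 10 => a 1 10 * w 1 2 + a 1 9 * w 1 3 + (a 1 8 - a 2 10) * w 1 4 +
    (a 1 7 - 2%:R * a 2 9) * w 1 5 +
    (a 1 6 - 3%:R * a 2 8 + a 3 10) * w 1 6 +
    (a 1 5 - 4%:R * a 2 7 + 3%:R * a 3 9) * w 1 7 +
    (a 1 4 - 5%:R * a 2 6 + 6%:R * a 3 8 - a 4 10) * w 1 8 +
    a 2 10 * w 2 3 + a 2 9 * w 2 4 + (a 2 8 - a 3 10) * w 2 5 +
    (a 2 7 - 2%:R * a 3 9) * w 2 6 +
    (a 2 6 - 3%:R * a 3 8 + a 4 10) * w 2 7 + a 3 10 * w 3 4 +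
    a 3 9 * w 3 5 + (a 3 8 - a 4 10) * w 3 6 + a 4 10 * w 4 5
  | _ => 0
  end.

Lemma coor_psiE k : (k < 11)%N -> coor (psi a u v) k = psi_coor k.
Proof.
move=> lt_k; rewrite coor_psi //; do 11?[case: k lt_k => [|k] lt_k //].
all: match goal with |- context [psi_support ?k] =>
  let q := eval vm_compute in (psi_support k) in
  rewrite (_ : psi_support k = q); last by vm_compute end.
all: rewrite ?big_cons big_nil /=; ring.
Qed.

Lemma coor_mu0 k : (k < 11)%N ->
  coor (mu0 u v) k = if (1 < k)%N then w 0 k.-1 else 0.
Proof.
move=> lt_k; rewrite coor_altmap big_ltn //.
rewrite [X in _ + X]big1_seq ?addr0; last first.
  move=> [|i] // _; apply: big1 => j _.
  by rewrite coor0 mulr0.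
rewrite big_mkcond unlock /= coor0 !coor_basis_vec //.
by do 11?[case: k lt_k => [|k] lt_k //] => /=; ring.
Qed.

Lemma coor_mu k : (k < 11)%N ->
  coor (mu a u v) k = (if (1 < k)%N then w 0 k.-1 else 0) + psi_coor k.
Proof. by move=> lt_k; rewrite coorD coor_mu0 // coor_psiE. Qed.

End Explicit.

(** * Bilinearity, skew-symmetry and Jacobi identity *)

Lemma plucker_linearr u i j : linear_for *%R (fun v => plucker u v i j).
Proof. by move=> c v v'; rewrite /plucker !coorD !coorZ; ring. Qed.

Lemma pluckerC u v i j : plucker u v i j = - plucker v u i j.
Proof. by rewrite /plucker; ring. Qed.

Lemma mu_linearr a u : linear (mu a u).
Proof.
move=> c v v'; apply: coorP => k lt_k.
rewrite [RHS]coorD coorZ !coor_mu // /psi_coor !plucker_linearr.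
by do 11?[case: k lt_k => [|k] lt_k //] => /=; ring.
Qed.

Lemma muC a u v : mu a u v = - mu a v u.
Proof.
apply: coorP => k lt_k; rewrite -scaleN1r coorZ !coor_mu // /psi_coor !(pluckerC u).
by do 11?[case: k lt_k => [|k] lt_k //] => /=; ring.
Qed.

Lemma mu_linearl a v : linear (mu a ^~ v).
Proof.
by move=> c u u'; rewrite ![mu a _ v]muC mu_linearr opprD scalerN.
Qed.

Lemma muxx a u : mu a u u = 0.
Proof.
apply: coorP => k lt_k; rewrite coor0 !coor_mu // /psi_coor /plucker.
by do 11?[case: k lt_k => [|k] lt_k //] => /=; ring.
Qed.

(** Makes the deformed bracket a member of the family [mu], so that all formulas for [mu] apply to
    it. *)
Definition shift17 a t (r s : nat) : K :=
  if (r, s) == (1, 7)%N then a r s + t else a r s.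

(* Neither mu0 nor a_(1,7) contributes to the Jacobiator of mu. *)
Lemma jacobi_mu_shift17 a t : in_F 11 a -> jacobi (@mu K 11 (shift17 a t)).
Proof.
move=> aF X Y Z; apply: etrans (aF X Y Z); apply: coorP => k lt_k.
rewrite [LHS]coorDD [RHS]coorDD !(coor_mu, coor_psiE) //.
do 11?[case: k lt_k => [|k] lt_k //] => /=.
all: rewrite /plucker ?(coor_mu, coor_psiE) //= /plucker.
all: rewrite /shift17 /=; ring.
Qed.

Lemma mu_tE a t u v : mu_t a t u v = mu (shift17 a t) u v.
Proof.
rewrite /mu_t /mu -addrA; congr (_ + _); rewrite /psi.
have sum_delta : \sum_(r < 11) \sum_(s < 11 | Delta 11 r s)
    (if (val r, val s) == (1, 7)%N then t else 0) *: psi_rs r s u v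
      = t *: psi_rs 1 7 u v.
  have neqE (i : 'I_11) k : i != inord k -> (nat_of_ord i == k) = false.
    by apply: contraNF => /eqP <-; rewrite inord_val.
  rewrite (bigD1 (inord 1)) //= (bigD1 (inord 7)) !inordK //=.
  rewrite [X in _ + X + _]big1 => [|s /andP[_ /neqE neq_s]]; last first.
    by rewrite xpair_eqE neq_s andbF scale0r.
  rewrite [X in _ + _ + X]big1 ?addr0 // => r /neqE neq_r; apply: big1 => s _.
  by rewrite xpair_eqE neq_r scale0r.
rewrite -sum_delta -big_split; apply: eq_bigr => r _.
rewrite -big_split; apply: eq_bigr => s _ /=.
by rewrite -scalerDl /shift17; case: ifP => _ //; rewrite addr0.
Qed.

(** * Brackets of basis vectors and Jacobi relations between the parameters *)

Lemma mu_basis0 a k : mu a (x_ 0) (x_ k.+1) = x_ k.+2.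
Proof.
apply: coorP => i lt_i.
rewrite coor_mu // /psi_coor /plucker !coor_basis_vec ?(leq_ltn_trans (leq_pred i)) //=.
by do 11?[case: i lt_i => [|i] lt_i //] => /=; rewrite ?eqSS; ring.
Qed.

Lemma mu_basis12 a : mu a (x_ 1) (x_ 2) = \sum_(4 <= k < 11) a 1 k *: x_ k.
Proof.
apply: coorP => i lt_i; rewrite coor_mu // [in RHS]unlock /= !coorD !coorZ coor0.
rewrite /psi_coor /plucker !coor_basis_vec ?(leq_ltn_trans (leq_pred i)) //=.
by do 11?[case: i lt_i => [|i] lt_i //] => /=; ring.
Qed.

Lemma mu_basis23 a : mu a (x_ 2) (x_ 3) = \sum_(6 <= k < 11) a 2 k *: x_ k.
Proof.
apply: coorP => i lt_i; rewrite coor_mu // [in RHS]unlock /= !coorD !coorZ coor0.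
rewrite /psi_coor /plucker !coor_basis_vec ?(leq_ltn_trans (leq_pred i)) //=.
by do 11?[case: i lt_i => [|i] lt_i //] => /=; ring.
Qed.

(** Coordinate 8 is the first in which the Jacobi identity on x_1, x_2, x_3 is not trivial;
    coordinate 9, treated next, is one weight higher. *)
Lemma in_F_rel8 a : in_F 11 a ->
  a 3 8 * (2%:R * a 1 4 + a 2 6) = 3%:R * a 2 6 ^+ 2.
Proof.
move=> /(_ (x_ 1) (x_ 2) (x_ 3)) /(congr1 (fun v => coor v 8)).
rewrite coorDD coor0 !coor_psiE //= /plucker !coor_psiE //= /plucker.
rewrite !coor_basis_vec //= => E.
by apply: subr0_eq; apply: (eq0_of_eq (c := -1) E); ring.
Qed.

Lemma in_F_rel9 a : in_F 11 a ->
  (2%:R * a 1 4 + a 2 6) * a 3 9 + 3%:R * (a 1 5 + a 2 7) * a 3 8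
    = 7%:R * a 2 6 * a 2 7.
Proof.
move=> /(_ (x_ 1) (x_ 2) (x_ 3)) /(congr1 (fun v => coor v 9)).
rewrite coorDD coor0 !coor_psiE //= /plucker !coor_psiE //= /plucker.
rewrite !coor_basis_vec //= => E.
by apply: subr0_eq; apply: (eq0_of_eq (c := -1) E); ring.
Qed.

(** * Lower central series of [mu] *)

Lemma lower_central_coor0 a k v i : (0 < k)%N -> (i <= k)%N -> (i < 11)%N ->
  v \in lower_central (@mu K 11 a) k -> coor v i = 0.
Proof.
elim: k v i => // k IH v i _ le_ik lt_i /=.
set X := (X in span X) => /(@coord_span _ _ _ (in_tuple X)) ->.
rewrite /coor summxE big1 // => j _; rewrite mxE -/(coor _ _).
have /allpairsP[[u w] [_ /vbasis_mem Uw ->]] /= : X`_j \in X by rewrite mem_nth.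
have w0 h : (0 < k)%N -> (h <= k)%N -> (h < 11)%N -> coor w h = 0.
  by move=> *; apply: IH Uw.
(* Coordinate [i] of a bracket involves only minors with both indices below [i], where [w] vanishes
   by induction. For [k = 0] only [i <= 1] occurs, and these coordinates of a bracket are 0. *)
have p0 h l : (1 < i)%N -> (h < i)%N -> (l < i)%N ->
    plucker u w h l = 0.
  move=> i_gt1 lt_h lt_l; have k_gt0 : (0 < k)%N by lia.
  by rewrite /plucker !w0 ?mulr0 ?subr0 //; lia.
rewrite coor_mu // /psi_coor; clear w0 le_ik.
by do 11?[case: i lt_i p0 => [|i] lt_i p0 //]; rewrite /= ?p0 //; ring.
Qed.

(** x_(k+1) arises from x_1 by bracketing [k] times with x_0. *)
Lemma basis_lower_central a k : (k < 10)%N ->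
  x_ k.+1 \in lower_central (@mu K 11 a) k.
Proof.
elim: k => [|k IH] lt_k; first exact: memvf.
rewrite -(mu_basis0 a); apply: (@memv_bracket K V).
- exact: mu_linearr.
- exact: mu_linearl.
- exact: memvf.
by apply: IH; apply: ltnW.
Qed.

Lemma filiform_mu a : filiform (@mu K 11 a).
Proof.
have dimV : \dim {:V} = 11%N by rewrite dimvf /dim /=.
split; rewrite dimV.
  apply/eqP; rewrite -subv0; apply/subvP => v LCv; rewrite memv0; apply/eqP.
  by apply: coorP => i lt_i; rewrite coor0; apply: (@lower_central_coor0 a 10) LCv.
move=> LC0; have := basis_lower_central a (isT : 9 < 10)%N.
rewrite LC0 memv0 => /eqP/(congr1 (fun v => coor v 10)).
by rewrite coor0 coor_basis_vec // => /eqP; rewrite oner_eq0.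
Qed.

End Coordinates.

(** * Constraints on an isomorphism, weight by weight *)

Section Rigidity.

Variables (K : fieldType) (a : nat -> nat -> K) (t : K).
Local Notation V := 'rV[K]_11.
Local Notation x_ := (@basis_vec K 11).
Variable f : {linear V -> V}.
Hypothesis f_inj : injective f.
Hypothesis fM : forall u v, f (mu (shift17 a t) u v) = mu a (f u) (f v).
Hypotheses (aU : in_U11 a) (two_neq0 : 2%:R != 0 :> K).
Local Notation F k i := (coor (f (x_ k)) i).

(** As x_(k+2) = [x_0, x_(k+1)], the rows 0 and 1 of the matrix [F] determine the others
    recursively. *)
Lemma F_succ k i : (i < 11)%N -> F k.+2 i =
  (if (1 < i)%N then F 0 0 * F k.+1 i.-1 - F 0 i.-1 * F k.+1 0 else 0)
  + psi_coor a (f (x_ 0)) (f (x_ k.+1)) i.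
Proof. by move=> lt_i; rewrite -(mu_basis0 (shift17 a t)) fM coor_mu. Qed.

Lemma F_lower_central k : f (x_ k.+1) \in lower_central (@mu K 11 a) k.
Proof.
elim: k => [|k IHk]; first exact: memvf.
rewrite -(mu_basis0 (shift17 a t)) fM; apply: (@memv_bracket K V) IHk.
- exact: mu_linearr.
- exact: mu_linearl.
- exact: memvf.
Qed.

(** f(x_(k+2)) lies in C^(k+1), so [F] is triangular from row 2 on. Row 1 escapes, since C^0 is the
    whole space. *)
Lemma F_eq0 k i : (i < k.+2)%N && (i < 11)%N -> F k.+2 i = 0.
Proof.
by case/andP=> lt_ik lt_i; apply: (lower_central_coor0 _ _ lt_i (F_lower_central k.+1)).
Qed.

Lemma F_rel12 i : (i < 11)%N ->
  \sum_(4 <= k < 11) shift17 a t 1 k * F k i = coor (mu a (f (x_ 1)) (f (x_ 2))) i.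
Proof.
move=> lt_i; rewrite -fM mu_basis12 linear_sum /coor summxE.
by apply: eq_bigr => k _; rewrite linearZ mxE.
Qed.

Lemma F_rel23 i : (i < 11)%N ->
  \sum_(6 <= k < 11) a 2 k * F k i = coor (mu a (f (x_ 2)) (f (x_ 3))) i.
Proof.
move=> lt_i; rewrite -fM mu_basis23 linear_sum /coor summxE.
by apply: eq_bigr => k _; rewrite linearZ mxE.
Qed.

Ltac F_vanish := repeat match goal with
  |- context [coor ?u ?i] => match u with context [basis_vec _ _ (S (S ?k))] =>
    rewrite (@F_eq0 k i isT) end end.

(** Coordinate i of [psi] involves only indices up to i - 2, where row k + 2 is zero for i = k + 3;
    only the bracket with x_0 contributes. *)
Lemma F_diag k : (k < 8)%N -> F k.+3 k.+3 = F 0 0 * F k.+2 k.+2.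
Proof.
move=> lt_k; rewrite F_succ // /psi_coor /plucker.
do 8?[case: k lt_k => [|k] lt_k //] => /=.
all: F_vanish; ring.
Qed.

Lemma F_diagX k : (k < 9)%N -> F k.+2 k.+2 = F 0 0 ^+ k * F 2 2.
Proof.
elim: k => [|k IHk] lt_k; first by rewrite mul1r.
by rewrite F_diag // IHk ?exprS ?mulrA // ltnW.
Qed.

(** By triangularity f(x_10) is a multiple of x_10, nonzero by injectivity, with coefficient
    [F 0 0 ^+ 8 * F 2 2]. *)
Lemma F00_F22_neq0 : (F 0 0 != 0) && (F 2 2 != 0).
Proof.
have: F 10 10 != 0.
  apply: contra_neq (oner_neq0 K) => F10_eq0.
  have fx10 : f (x_ 10) = f 0.
    rewrite linear0; apply: coorP => i lt_i; rewrite coor0.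
    by have [->//|ne_i] := eqVneq i 10%N; apply: F_eq0; lia.
  by have /(congr1 (fun v => coor v 10)) := f_inj fx10; rewrite coor0 coor_basis_vec.
by rewrite F_diagX // mulf_eq0 negb_or expf_eq0.
Qed.

Lemma F10_eq0 : F 1 0 = 0.
Proof.
have /andP[_ F22] := F00_F22_neq0.
(* At coordinate 3 the left side vanishes and the right side is [F 1 0 * F 2 2]. *)
have := @F_rel12 3 isT; rewrite coor_mu // unlock /= /plucker; F_vanish => E.
by apply: (mulIf F22); rewrite mul0r; apply: (eq0_of_eq (c := -1) E); ring.
Qed.

Lemma F22E : F 2 2 = F 0 0 * F 1 1.
Proof. by rewrite F_succ //= /plucker F10_eq0; ring. Qed.

(** The weight 0 part of [x_1, x_2] is coordinate 4: it reads
    [a 1 4 * F 4 4 = a 1 4 * (F 1 1 * F 2 2)]. *)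
Lemma F11E : F 1 1 = F 0 0 ^+ 2.
Proof.
have /andP[c_neq0 F22] := F00_F22_neq0.
have := @F_rel12 4 isT; rewrite coor_mu // unlock /= /plucker F10_eq0; F_vanish.
rewrite (@F_diagX 2) // F22E => E.
rewrite F22E in F22.
have [_ [a14 _ _ _ _]] := aU.
apply/subr0_eq.
apply: (mulIf (mulf_neq0 a14 F22)); rewrite mul0r; apply: (eq0_of_eq (c := -1) E).
rewrite /shift17 /=; ring.
Qed.

Lemma F_diagE k : (k < 9)%N -> F k.+2 k.+2 = F 0 0 ^+ k.+3.
Proof. by move=> lt_k; rewrite F_diagX // F22E F11E -exprS -exprD addn3. Qed.

(** The weight 1 entries of [F], from the recursion [F_succ]. *)
Lemma F_offdiag :
  [/\ F 2 3 = F 0 0 * F 1 2,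
      F 3 4 = F 0 0 ^+ 2 * F 1 2 + a 1 4 * F 0 0 ^+ 3 * F 0 1,
      F 4 5 = F 0 0 ^+ 3 * F 1 2 + 2%:R * a 1 4 * F 0 0 ^+ 4 * F 0 1,
      F 5 6 = F 0 0 ^+ 4 * F 1 2 + (3%:R * a 1 4 - a 2 6) * F 0 0 ^+ 5 * F 0 1
    & F 6 7 = F 0 0 ^+ 5 * F 1 2
              + (4%:R * a 1 4 - 3%:R * a 2 6) * F 0 0 ^+ 6 * F 0 1].
Proof.
have E23 : F 2 3 = F 0 0 * F 1 2.
  by rewrite F_succ //= /plucker F10_eq0; ring.
have E34 : F 3 4 = F 0 0 ^+ 2 * F 1 2 + a 1 4 * F 0 0 ^+ 3 * F 0 1.
  by rewrite F_succ //= /plucker; F_vanish; rewrite E23 (@F_diagE 0) //; ring.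
have E45 : F 4 5 = F 0 0 ^+ 3 * F 1 2 + 2%:R * a 1 4 * F 0 0 ^+ 4 * F 0 1.
  by rewrite F_succ //= /plucker; F_vanish; rewrite E34 (@F_diagE 1) //; ring.
have E56 : F 5 6 = F 0 0 ^+ 4 * F 1 2 + (3%:R * a 1 4 - a 2 6) * F 0 0 ^+ 5 * F 0 1.
  by rewrite F_succ //= /plucker; F_vanish; rewrite E45 (@F_diagE 2) //; ring.
split=> //; rewrite F_succ //= /plucker; F_vanish.
by rewrite E56 (@F_diagE 3) //; ring.
Qed.

Lemma F00_F01 : F 0 0 = 1 /\ F 0 1 = 0.
Proof.
have [c_neq0 _] := andP F00_F22_neq0.
have [_ [a14 a15 aD a26 a38]] := aU.
have [E23 E34 E45 E56 E67] := F_offdiag.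
have := @F_rel12 5 isT; rewrite coor_mu // unlock /= /plucker F10_eq0; F_vanish.
rewrite /shift17 /= E45 E23 (@F_diagE 3) // (@F_diagE 0) // F11E => E12.
have := @F_rel23 7 isT; rewrite coor_mu // unlock /= /plucker; F_vanish.
rewrite E67 E23 E34 (@F_diagE 5) // (@F_diagE 0) // (@F_diagE 1) // => E23'.
set c := F 0 0 in c_neq0 E12 E23' *; set p1 := F 0 1 in E12 E23' *.
have R12 : 2%:R * a 1 4 ^+ 2 * p1 = a 1 5 * c * (1 - c).
  apply: subr0_eq; apply: (mulIf (expf_neq0 4 c_neq0)); rewrite mul0r.
  by apply: (eq0_of_eq (c := 1) E12); ring.
have R23 : 3%:R * a 2 6 * (a 1 4 - a 2 6) * p1 = a 2 7 * c * (1 - c).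
  apply: subr0_eq; apply: (mulIf (expf_neq0 6 c_neq0)); rewrite mul0r.
  by apply: (eq0_of_eq (c := 1) E23'); ring.
have c1 : c = 1.
  rewrite -subr_eq0 in aD.
  apply/esym/subr0_eq; apply: (mulIf (mulf_neq0 c_neq0 aD)); rewrite mul0r.
  (* This combination of [R12] and [R23] eliminates [p1], leaving c(1 - c) times the difference of
     the two sides of the third inequality defining U. *)
  transitivity (3%:R * a 2 6 * (a 1 4 - a 2 6) * (a 1 5 * c * (1 - c))
                - 2%:R * a 1 4 ^+ 2 * (a 2 7 * c * (1 - c))); first by ring.
  by rewrite -R12 -R23; ring.
split=> //; move: R12; rewrite c1 subrr mulr0 => /eqP.
by rewrite !mulf_eq0 (negPf two_neq0) (negPf a14) /= => /eqP.
Qed.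

(** Every [psi] term in the weight 1 recursion carries the factor [F 0 1], now known to be 0. *)
Lemma F_unip :
  (forall k, (k < 9)%N -> F k.+2 k.+2 = 1) /\
  (forall k, (k < 8)%N -> F k.+2 k.+3 = F 1 2).
Proof.
have [c1 p1] := F00_F01.
have diag k : (k < 9)%N -> F k.+2 k.+2 = 1.
  by move=> lt_k; rewrite F_diagE // c1 expr1n.
split=> // k; elim: k => [|k IHk] lt_k.
  by have [-> _ _ _ _] := F_offdiag; rewrite c1 mul1r.
have {}IHk := IHk (ltnW lt_k); rewrite F_succ // /psi_coor /plucker c1 p1.
rewrite (@F_eq0 k 0) //= IHk; do 7?[case: k lt_k IHk => [|k] lt_k IHk //] => /=.
all: F_vanish; ring.
Qed.

(** The weight 2 entries of [F], once c = 1 and p_1 = 0. *)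
Lemma F_second :
  [/\ F 2 4 = F 1 3 - a 1 4 * F 0 2,
      F 3 5 = F 1 3 - a 1 4 * F 0 2,
      F 4 6 = F 1 3 + (a 2 6 - a 1 4) * F 0 2,
      F 5 7 = F 1 3 + (2%:R * a 2 6 - a 1 4) * F 0 2
    & F 6 8 = F 1 3 + (3%:R * a 2 6 - a 1 4 - a 3 8) * F 0 2 /\
      F 7 9 = F 1 3 + (4%:R * a 2 6 - a 1 4 - 3%:R * a 3 8) * F 0 2].
Proof.
have [c1 p1] := F00_F01; have [diag offd] := F_unip.
have E24 : F 2 4 = F 1 3 - a 1 4 * F 0 2.
  by rewrite F_succ //= /plucker F10_eq0 F11E c1 p1; ring.
have E35 : F 3 5 = F 1 3 - a 1 4 * F 0 2.
  by rewrite F_succ //= /plucker; F_vanish; rewrite c1 p1 E24 ?diag ?offd //; ring.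
have E46 : F 4 6 = F 1 3 + (a 2 6 - a 1 4) * F 0 2.
  by rewrite F_succ //= /plucker; F_vanish; rewrite c1 p1 E35 ?diag ?offd //; ring.
have E57 : F 5 7 = F 1 3 + (2%:R * a 2 6 - a 1 4) * F 0 2.
  by rewrite F_succ //= /plucker; F_vanish; rewrite c1 p1 E46 ?diag ?offd //; ring.
have E68 : F 6 8 = F 1 3 + (3%:R * a 2 6 - a 1 4 - a 3 8) * F 0 2.
  by rewrite F_succ //= /plucker; F_vanish; rewrite c1 p1 E57 ?diag ?offd //; ring.
have E79 : F 7 9 = F 1 3 + (4%:R * a 2 6 - a 1 4 - 3%:R * a 3 8) * F 0 2.
  by rewrite F_succ //= /plucker; F_vanish; rewrite c1 p1 E68 ?diag ?offd //; ring.
by [].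
Qed.

(** The weight 3 entries of [F]; weight 3 is where the parameter [t] first enters. *)
Lemma F_third :
  [/\ F 2 5 = F 1 4 - a 1 4 * F 0 3 - a 1 5 * F 0 2,
      F 3 6 = F 1 4 - a 1 4 * F 0 3 - a 1 5 * F 0 2
    + a 2 6 * (F 0 2 * F 1 2 - F 0 3),
      F 4 7 = F 1 4 - a 1 4 * F 0 3 - a 1 5 * F 0 2
    + a 2 6 * (2%:R * F 0 2 * F 1 2 - F 0 3)
    + a 2 7 * F 0 2,
      F 5 8 = F 1 4 - a 1 4 * F 0 3 - a 1 5 * F 0 2
    + a 2 6 * (3%:R * F 0 2 * F 1 2 - F 0 3)
    + 2%:R * a 2 7 * F 0 2 - a 3 8 * (F 0 2 * F 1 2 - F 0 3)
    & F 6 9 = F 1 4 - a 1 4 * F 0 3 - a 1 5 * F 0 2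
    + a 2 6 * (4%:R * F 0 2 * F 1 2 - F 0 3)
    + 3%:R * a 2 7 * F 0 2
    - a 3 8 * (3%:R * F 0 2 * F 1 2 - 2%:R * F 0 3) - a 3 9 * F 0 2].
Proof.
have [c1 p1] := F00_F01; have [diag offd] := F_unip.
have [E24 E35 E46 E57 [E68 E79]] := F_second.
have E25 : F 2 5 = F 1 4 - a 1 4 * F 0 3 - a 1 5 * F 0 2.
  by rewrite F_succ //= /plucker F10_eq0 F11E c1 p1; ring.
have E36 : F 3 6 = F 1 4 - a 1 4 * F 0 3 - a 1 5 * F 0 2
    + a 2 6 * (F 0 2 * F 1 2 - F 0 3).
  by rewrite F_succ //= /plucker; F_vanish; rewrite c1 p1 E25 ?diag ?offd ?E24 //; ring.
have E47 : F 4 7 = F 1 4 - a 1 4 * F 0 3 - a 1 5 * F 0 2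
    + a 2 6 * (2%:R * F 0 2 * F 1 2 - F 0 3)
    + a 2 7 * F 0 2.
  by rewrite F_succ //= /plucker; F_vanish; rewrite c1 p1 E36 ?diag ?offd ?E35 //; ring.
have E58 : F 5 8 = F 1 4 - a 1 4 * F 0 3 - a 1 5 * F 0 2
    + a 2 6 * (3%:R * F 0 2 * F 1 2 - F 0 3)
    + 2%:R * a 2 7 * F 0 2 - a 3 8 * (F 0 2 * F 1 2 - F 0 3).
  by rewrite F_succ //= /plucker; F_vanish; rewrite c1 p1 E47 ?diag ?offd ?E46 //; ring.
have E69 : F 6 9 = F 1 4 - a 1 4 * F 0 3 - a 1 5 * F 0 2
    + a 2 6 * (4%:R * F 0 2 * F 1 2 - F 0 3)
    + 3%:R * a 2 7 * F 0 2
    - a 3 8 * (3%:R * F 0 2 * F 1 2 - 2%:R * F 0 3) - a 3 9 * F 0 2.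
  by rewrite F_succ //= /plucker; F_vanish; rewrite c1 p1 E58 ?diag ?offd ?E57 //; ring.
by [].
Qed.

Lemma shift_eq0 : t = 0.
Proof.
have [c1 p1] := F00_F01; have [diag offd] := F_unip.
have [E24 E35 E46 E57 [E68 E79]] := F_second.
have [E25 E36 E47 E58 E69] := F_third.
have [aF [a14 a15 aD a26 a38]] := aU.
(* [S] is the cofactor of [a 2 6] in coordinate 7 of [x_1, x_2], its weight 3 part. *)
pose S := 3%:R * a 1 4 * (F 0 3 - F 0 2 * F 1 2) + F 1 2 * F 1 3 - 3%:R * F 1 4.
have := @F_rel12 6 isT; rewrite coor_mu // unlock /= /plucker F10_eq0; F_vanish.
rewrite /shift17 /= E46 E24 (@offd 3) // (@offd 0) //.
rewrite (@diag 0) // (@diag 4) // F11E c1 => E12.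
(* Weight 2: coordinate 6 of [x_1, x_2] says that [a 2 6] times the difference of the two sides is
   0. *)
have R12 : F 1 2 ^+ 2 = 2%:R * F 1 3.
  apply: subr0_eq; apply: (mulIf a26); rewrite mul0r.
  by apply: (eq0_of_eq (c := -1) E12); ring.
have := @F_rel12 7 isT; rewrite coor_mu // unlock /= /plucker F10_eq0; F_vanish.
rewrite /shift17 /= E47 E57 E24 E25 (@offd 4) // (@offd 0) //.
rewrite (@diag 0) // (@diag 5) // F11E c1 => E12'.
have tE : t - a 2 6 * S - a 2 7 * (F 1 2 ^+ 2 - 2%:R * F 1 3) = 0.
  by apply: (eq0_of_eq (c := 1) E12'); rewrite /S; ring.
have := @F_rel23 9 isT; rewrite coor_mu // unlock /= /plucker; F_vanish.
rewrite E69 E79 E24 E25 E35 E36 (@offd 6) // (@offd 0) //.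
rewrite (@offd 1) // (@diag 0) // (@diag 1) // (@diag 7) // => E23.
(* The weight 3 part of [x_2, x_3], grouped so that all terms but the first vanish by the two Jacobi
   relations and [R12]. *)
have zSE : a 3 8 * S
    + F 0 2 * F 1 2 * (a 3 8 * (2%:R * a 1 4 + a 2 6) - 3%:R * a 2 6 ^+ 2)
    + F 0 2 * ((2%:R * a 1 4 + a 2 6) * a 3 9 + 3%:R * (a 1 5 + a 2 7) * a 3 8
               - 7%:R * a 2 6 * a 2 7)
    + a 3 9 * (F 1 2 ^+ 2 - 2%:R * F 1 3) = 0.
  by apply: (eq0_of_eq (c := -1) E23); rewrite /S; ring.
have S0 : S = 0.
  apply: (mulfI a38); move: zSE.
  by rewrite (in_F_rel8 aF) (in_F_rel9 aF) R12 !subrr !mulr0 !addr0.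
by move: tE; rewrite S0 R12 subrr !mulr0 !subr0.
Qed.

End Rigidity.

(** * Lie algebra structure of [mu_t] and conclusion *)

Section Family.

Variables (K : fieldType) (a : nat -> nat -> K) (t : K).

Lemma lie_bracket_mu_t : in_F 11 a -> lie_bracket (mu_t a t).
Proof.
move=> aF; split=> [u c v w|v c u w|u|X Y Z]; rewrite ?mu_tE.
- exact: mu_linearr.
- exact: mu_linearl.
- exact: muxx.
- exact: jacobi_mu_shift17.
Qed.

(** [mu_tE] is a pointwise equality, so the lower central series are compared term by term. *)
Lemma filiform_mu_t : filiform (mu_t a t).
Proof.
have LC k : lower_central (mu_t a t) k = lower_central (@mu K 11 (shift17 a t)) k.
  by elim: k => //= k ->; congr span; apply: eq_allpairs => u v; rewrite mu_tE.
by rewrite /filiform !LC; apply: filiform_mu.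
Qed.

Lemma lie_isomorphic_mu_t : (2%:R != 0 :> K) -> in_U11 a ->
  lie_isomorphic (mu_t a t) (@mu K 11 a) <-> t = 0.
Proof.
move=> two_neq0 aU; split=> [[f [f_bij fM]]|->].
  apply: (shift_eq0 (bij_inj f_bij) _ aU two_neq0) => u v.
  by rewrite -mu_tE fM.
exists idfun; split=> [|u v /=]; first by exists idfun.
by rewrite /mu_t scale0r addr0.
Qed.

End Family.

Theorem proposition5p3 (R : realType) (a : nat -> nat -> complex R)
    (ha : in_U11 a) (t : complex R) :
  [/\ lie_bracket (mu_t a t), filiform (mu_t a t)
    & lie_isomorphic (mu_t a t) (@mu (complex R) 11 a) <-> t = 0].
Proof.
have [aF _] := ha.
split; [exact: lie_bracket_mu_t|exact: filiform_mu_t|].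
by apply: lie_isomorphic_mu_t ha; rewrite Num.Theory.pnatr_eq0.
Qed.
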